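(* For every integer $k\ge 2$ there are constants $C_k,K_k>0$ such that $P_k(n,\epsilon,3)\le C_k\,\epsilon^{2-2^k}$ for all $n$ and all $\epsilon\le 1$ with $\epsilon\ge K_k\, n^{-2^{1-k}}$; i.e. $P_k(n,\epsilon,3)=O(\epsilon^{2-2^k})$.
   Context: A hypergraph is $k$-uniform if each edge has exactly $k$ vertices. A (tight) path of length $\ell$ in a $k$-uniform hypergraph is a subhypergraph consisting of $\ell+k-1$ vertices $v_1,\dots,v_{\ell+k-1}$ and the $\ell$ edges $\{v_i,v_{i+1},\dots,v_{i+k-1}\}$, $1\le i\le \ell$, all of which must be edges; its endpoints are $v_1$ and $v_{\ell+k-1}$. The distance between two vertices is the length of a shortest tight path with those endpoints ($\infty$ if none), and the diameter of a hypergraph is the maximum distance between two of its vertices. For an edge set $E'$, its diameter is that of the hypergraph with edge set $E'$ on the vertices covered by $E'$. $P_k(n,\epsilon,d)$ is the smallest $\ell$ such that every $k$-uniform hypergraph $G=(V,E)$ on $n$ vertices has an edge partition $E=E_0\cup E_1\cup\cdots\cup E_\ell$ with $|E_0|\le \epsilon n^k$ and the diameter of $E_i$ at most $d$ for $1\le i\le\ell$. *)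

(* Defs.v *)
From HB Require Import structures.
From mathcomp Require Import all_boot all_order all_algebra.
From mathcomp Require Import all_classical all_reals.
From mathcomp Require Import ereal exp.

Set Implicit Arguments.
Unset Strict Implicit.
Unset Printing Implicit Defensive.

Import Order.TTheory GRing.Theory Num.Theory.

Local Open Scope ring_scope.

(* A hypergraph on the vertex type T is its edge set E : {set {set T}}. *)
Definition uniform (T : finType) (k : nat) (E : {set {set T}}) : Prop :=
  forall e : {set T}, e \in E -> #|e| = k.

(* The minimum of a set of naturals, with value +oo on the empty set. *)
Definition minset_nat (R : realType) (A : set nat) : \bar R :=
  ereal_inf [set (l%:R)%:E | l in A]%classic.

(* The requirement 0 < l is essential: a sequence of k - 1 vertices spans no
   edge, and for k >= 3 it would otherwise join arbitrary vertices. *)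
Definition tight_path (T : finType) (k : nat) (E : {set {set T}})
    (l : nat) (p : seq T) : bool :=
  [&& (0 < l)%N, size p == (l + k - 1)%N, uniq p
    & all (fun i => [set x in take k (drop i p)]%SET \in E) (iota 0 l)].

(* Meaningful for u != v. *)
Definition tdist (R : realType) (T : finType) (k : nat) (E : {set {set T}})
    (u v : T) : \bar R :=
  minset_nat R [set l | exists p : seq T,
                          tight_path k E l (u :: p) /\ last u p = v]%classic.

(* The vertices covered by E form finset.cover E; the diameter is 0 when E is
   empty. *)
Definition diam (R : realType) (T : finType) (k : nat) (E : {set {set T}}) :
    \bar R :=
  (\big[maxe/0]_(p : T * T |
      [&& p.1 \in finset.cover E, p.2 \in finset.cover E & p.1 != p.2])
      tdist R k E p.1 p.2)%E.

(* The classes may be empty. *)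
Definition diam_partition (R : realType) (n k : nat) (eps : R) (d : nat)
    (E : {set {set 'I_n}}) (l : nat) (F : 'I_l.+1 -> {set {set 'I_n}}) : Prop :=
  [/\ (\bigcup_i F i)%SET = E,
      forall i j : 'I_l.+1, i != j -> [disjoint F i & F j],
      #|F ord0|%:R <= eps * n%:R ^+ k
    & forall i : 'I_l.+1, i != ord0 -> (diam R k (F i) <= (d%:R)%:E)%E].

Definition Pdiam (R : realType) (k n : nat) (eps : R) (d : nat) : \bar R :=
  minset_nat R [set l | forall E : {set {set 'I_n}}, uniform k E ->
    exists F : 'I_l.+1 -> {set {set 'I_n}}, diam_partition k eps d E F]%classic.

(* Main.v *)
(* Let the ball of an edge e be the set of all vertices v such that v is in e
   or e - x + v is an edge for some x in e. The edges inside this ball form a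
   hypergraph of diameter at most 3: if e - x + u and e - y + v are edges, then
   u, y, (e without x and y), x, v is a tight path.
   By iterated Cauchy-Schwarz, a k-uniform hypergraph with m n^k edges contains
   at least m^(2^k) n^(2k) homomorphic copies of the complete k-partite
   hypergraph K(2,...,2), hence, averaging over its edges, some ball contains at
   least m^(2^k-1) n^k edges. Removing the edges of such a ball takes m to
   at most m - m^(2^k-1), so after t removals m^(2^k-2) <= 1/t, and
   t = O(eps^(2-2^k)) removals leave at most eps n^k edges. *)
Require Import Defs.
From HB Require Import structures.
From mathcomp Require Import all_boot all_order all_algebra.
From mathcomp Require Import all_classical all_reals.
From mathcomp Require Import ereal exp.
From mathcomp Require Import ring lra.

Set Implicit Arguments.
Unset Strict Implicit.
Unset Printing Implicit Defensive.

Import Order.TTheory GRing.Theory Num.Theory.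

Local Open Scope nat_scope.

(** * Power mean inequalities over the naturals, with denominators cleared *)

Lemma leq_sqr_sum (I : finType) (a : I -> nat) :
  (\sum_i a i) ^ 2 <= #|I| * \sum_i a i ^ 2.
Proof.
(* After doubling, it suffices to sum 2 a_i a_j <= a_i^2 + a_j^2 over all ordered pairs. *)
rewrite -(leq_pmul2l (ltn0Sn 1)) -mulnn big_distrlr big_distrr /=.
have -> : 2 * (#|I| * \sum_i a i ^ 2) = \sum_i \sum_j (a i ^ 2 + a j ^ 2).
  under [RHS]eq_bigr => i _ do rewrite big_split /= sum_nat_const.
  by rewrite big_split /= -big_distrr sum_nat_const /= mul2n addnn.
apply: leq_sum => i _; rewrite big_distrr /=.
by apply: leq_sum => j _; exact: nat_Cauchy.
Qed.

(** Induction on [m]: Cauchy-Schwarz raised to the power 2^m, then the induction hypothesis for the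
    squares of [a]. *)
Lemma leq_exp_sum (I : finType) (m : nat) (a : I -> nat) :
  #|I| * (\sum_i a i) ^ (2 ^ m) <= #|I| ^ (2 ^ m) * \sum_i a i ^ (2 ^ m).
Proof.
elim: m a => [|m IHm] a; first by rewrite expn1.
have E2 x : x ^ (2 ^ m.+1) = (x ^ 2) ^ (2 ^ m) by rewrite expnS expnM.
rewrite E2; under [X in _ <= _ * X]eq_bigr => i _ do rewrite E2.
have -> : #|I| ^ (2 ^ m.+1) = #|I| ^ (2 ^ m) * #|I| ^ (2 ^ m).
  by rewrite expnS mul2n -addnn expnD.
rewrite -mulnA; apply: leq_trans (leq_mul (leqnn _) (IHm _)).
rewrite mulnCA -expnMn leq_mul2l leq_exp2r ?expn_gt0 // leq_sqr_sum.
exact: orbT.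
Qed.

(** * Counting homomorphic copies of K(2,...,2) *)

Section Boxes.
Variable T : finType.

(* [boxed f u w] says that [f] holds of all the [2 ^ k] sequences whose i-th
   entry is the i-th entry of [u] or of [w]. *)
Fixpoint boxed (f : pred (seq T)) (u w : seq T) : bool :=
  match u, w with
  | x :: u', y :: w' => boxed (fun s => f (x :: s) && f (y :: s)) u' w'
  | _, _ => f [::]
  end.

Lemma boxed_left f u w : size u = size w -> boxed f u w -> f u.
Proof.
elim: u w f => [|x u IHu] [|y w] f //= [] /IHu {}IHu.
by move/IHu/andP=> [].
Qed.

Lemma boxed_right f u w : size u = size w -> boxed f u w -> f w.
Proof.
elim: u w f => [|x u IHu] [|y w] f //= [] /IHu {}IHu.
by move/IHu/andP=> [].
Qed.

(** One of the boxed sequences follows [w] at a position of [v] and [u] everywhere else. *)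
Lemma boxed_swap f u w v : size u = size w -> boxed f u w -> v \in w ->
  exists s1 x s2, u = s1 ++ x :: s2 /\ f (s1 ++ v :: s2).
Proof.
elim: u w f => [|x u IHu] [|y w] f //= [] suw fuw.
rewrite inE => /predU1P[->|vw].
  by exists [::], x, u; split=> //; case/andP: (boxed_left suw fuw).
have [s1 [z [s2 [-> /andP[fs _]]]]] := IHu _ _ suw fuw vw.
by exists (x :: s1), z, s2.
Qed.

Lemma big_tuple_cons k (F : k.+1.-tuple T -> nat) :
  \sum_t F t = \sum_(x : T) \sum_(t : k.-tuple T) F [tuple of x :: t].
Proof.
rewrite pair_big /=.
rewrite (reindex (fun p : T * k.-tuple T => [tuple of p.1 :: p.2])) //=.
exists (fun t : k.+1.-tuple T => (thead t, [tuple of behead t])).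
  by move=> [x t] _; congr pair; apply: val_inj.
by move=> t _; rewrite [t in RHS]tuple_eta.
Qed.

(** Induction on [k]. Cauchy-Schwarz over the tails turns the square of the count into a sum over
    pairs of heads [x], [y]; the power mean inequality moves the exponent 2^k inside this sum, and
    the induction hypothesis applies to each pair. *)
Lemma box_count k (f : pred (seq T)) :
  (\sum_(t : k.-tuple T) f t) ^ (2 ^ k) * #|T| ^ (2 * k) <=
  (\sum_(u : k.-tuple T) \sum_(w : k.-tuple T) boxed f u w)
     * #|T| ^ (k * 2 ^ k).
Proof.
elim: k f => [|k IHk] f.
  have one (F : 0.-tuple T -> nat) : \sum_t F t = F [tuple].
    by rewrite (big_pred1 [tuple]) // => t; apply/esym/eqP; rewrite tuple0.
  by rewrite !one.
pose g (p : T * T) : pred (seq T) := fun s => f (p.1 :: s) && f (p.2 :: s).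
pose a p := \sum_(t : k.-tuple T) g p t.
pose b p := \sum_(u : k.-tuple T) \sum_(w : k.-tuple T) boxed (g p) u w.
have -> : \sum_(u : k.+1.-tuple T) \sum_(w : k.+1.-tuple T) boxed f u w
          = \sum_p b p.
  rewrite -(pair_bigA _ (fun x y => b (x, y))) big_tuple_cons /=.
  apply: eq_bigr => x _; rewrite exchange_big big_tuple_cons /=.
  by apply: eq_bigr => y _; rewrite exchange_big.
have CS : (\sum_(t : k.+1.-tuple T) f t) ^ 2 <= #|T| ^ k * \sum_p a p.
  rewrite big_tuple_cons exchange_big /=.
  apply: leq_trans (leq_sqr_sum _) _; rewrite card_tuple leq_mul2l.
  apply/orP; right; rewrite exchange_big /=.
  apply: leq_sum => t _; rewrite -mulnn big_distrlr /= pair_big /=.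
  by apply: leq_sum => p _; rewrite mulnb.
have card2 : #|{: T * T}| = #|T| ^ 2 by rewrite card_prod mulnn.
have PM := leq_exp_sum k a; rewrite card2 in PM.
have step : (\sum_p a p ^ 2 ^ k) * #|T| ^ (2 * k) <=
            (\sum_p b p) * #|T| ^ (k * 2 ^ k).
  by rewrite !big_distrl; apply: leq_sum => p _; exact: IHk.
set A := \sum_(t : k.+1.-tuple T) f t in CS *; set B := \sum_p b p in step *.
set S := \sum_p a p in CS PM; set S' := \sum_p a p ^ _ in PM step.
set N := #|T| in CS PM step *; set m := 2 ^ k in PM step *.
have m_gt0 : 0 < m by rewrite expn_gt0.
have -> : A ^ (2 ^ k.+1) = (A ^ 2) ^ m by rewrite expnS expnM.
have -> : N ^ (2 * k.+1) = N ^ 2 * N ^ (2 * k) by rewrite mulnS expnD.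
have -> : N ^ (k.+1 * 2 ^ k.+1) = N ^ (k * m) * ((N ^ 2) ^ m * N ^ (k * m)).
  rewrite -expnM -!expnD; congr (_ ^ _); rewrite expnS -/m.
  by rewrite mulSn [k * _]mulnCA [2 * (k * m)]mul2n -addnn addnCA.
apply: (@leq_trans ((N ^ k * S) ^ m * (N ^ 2 * N ^ (2 * k)))).
  by rewrite leq_mul2r leq_exp2r // CS orbT.
rewrite expnMn -expnM -mulnA [leqRHS]mulnCA leq_mul2l; apply/orP; right.
rewrite mulnA [S ^ m * _]mulnC.
apply: leq_trans (leq_mul PM (leqnn _)) _.
by rewrite -mulnA [leqRHS]mulnCA leq_mul2l step orbT.
Qed.

(** Each edge has [k]! orderings, and a tuple with a repeated entry has too few distinct entries to
    give an edge. *)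
Lemma card_tuples_set k (E : {set {set T}}) : uniform k E ->
  \sum_(t : k.-tuple T) ([set x in t]%SET \in E) = k`! * #|E|.
Proof.
move=> unifE.
rewrite -big_mkcond /= (partition_big (fun t : k.-tuple T => [set x in t]%SET)
  [in E]) //= mulnC -sum_nat_const.
apply: eq_bigr => A AE; rewrite -ffactnn -[X in X ^_ _](unifE _ AE).
rewrite -card_uniq_tuples sum1dep_card; apply: eq_card => t.
rewrite !inE; apply/andP/andP=> [[_ /eqP tA]|[/allP tA ut]].
  split; first by apply/allP=> x xt; change (x \in A); rewrite -tA inE.
  by apply/card_uniqP; rewrite size_tuple -cardsE tA unifE.
have tE : [set x in t]%SET = A.
  apply/eqP; rewrite eqEcard unifE // cardsE (card_uniqP ut) size_tuple leqnn.
  by rewrite andbT; apply/fintype.subsetP=> x; rewrite inE; exact: tA.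
by rewrite tE.
Qed.

End Boxes.

(** * Existence of a ball with many edges *)

Section Balls.
Variables (T : finType) (k : nat) (E : {set {set T}}).
Hypothesis unifE : uniform k E.

Definition ball (e : {set T}) : {set T} :=
  e :|: [set v | [exists x in e, v |: e :\ x \in E]]%SET.

Definition ball_edges (e : {set T}) : {set {set T}} :=
  [set A in E | A \subset ball e]%SET.

Lemma boxed_ball (u w : k.-tuple T) :
  boxed (fun s => [set x in s]%SET \in E) u w ->
  [set x in w]%SET \in ball_edges [set x in u]%SET.
Proof.
move=> uw; have suw : size u = size w by rewrite !size_tuple.
have uE := boxed_left suw uw; rewrite inE (boxed_right suw uw).
have uu : uniq u by apply/card_uniqP; rewrite size_tuple -cardsE unifE.
apply/fintype.subsetP=> v; rewrite inE => vw.
have [s1 [x [s2 [us vE]]]] := boxed_swap suw uw vw.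
rewrite !inE; apply/orP; right; apply/existsP; exists x.
have uP z : (z \in u) = (z \in s1 ++ x :: s2) by rewrite -us.
rewrite inE uP mem_cat mem_head orbT /=; move: uu; rewrite us cat_uniq /=.
case/and3P=> _ /norP[xs1 _] /andP[xs2 _].
suff -> : v |: [set z in u] :\ x = [set z in s1 ++ v :: s2]%SET by [].
apply/setP=> z; rewrite !inE uP !mem_cat !inE.
case: (eqVneq z x) => [->|_] /=; last by rewrite orbCA.
by rewrite (negPf xs1) (negPf xs2) !orbF.
Qed.

(* By [boxed_ball], the pairs counted in [box_count] with first component [u]
   inject into the ordered edges inside the ball of [u]: average over [u]. *)
Lemma dense_ball q : 2 ^ k = q.+2 -> E != finset.set0 ->
  exists2 e, e \in E & #|E| ^ q.+1 <= #|ball_edges e| * (#|T| ^ k) ^ q.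
Proof.
move=> kq /set0Pn[e0 e0E].
have [e eE emax] : exists2 e, e \in E &
    forall e', e' \in E -> #|ball_edges e'| <= #|ball_edges e|.
  by have [e eE emax] := arg_maxnP (fun e => #|ball_edges e|) e0E; exists e.
exists e => //.
have F0 : 0 < k`! by exact: fact_gt0.
have E0 : 0 < #|E| by apply/card_gt0P; exists e.
have N0 : 0 < #|T| ^ k.
  rewrite expn_gt0; case: k unifE => [|k'] uE; first by rewrite orbT.
  suff: 0 < #|e| by move=> /leq_trans->//; exact: max_card.
  by rewrite uE.
pose f (s : seq T) := [set x in s]%SET \in E.
have cnt := card_tuples_set unifE.
have ubE : uniform k (ball_edges e) by move=> A; rewrite inE => /andP[/unifE].
have box_le : \sum_(u : k.-tuple T) \sum_(w : k.-tuple T) boxed f u w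
    <= (k`! * #|E|) * (k`! * #|ball_edges e|).
  rewrite -cnt big_distrl /=; apply: leq_sum => u _.
  have [uE|uE] := boolP (_ \in E); last first.
    rewrite big1 // => w _; apply/eqP; rewrite eqb0; apply: contra uE.
    by apply: boxed_left; rewrite !size_tuple.
  rewrite mul1n.
  apply: leq_trans (_ : _ <= k`! * #|ball_edges [set x in u]%SET|) _.
    rewrite -card_tuples_set; last by move=> A; rewrite inE => /andP[/unifE].
    by apply: leq_sum => w _; case: (boolP (boxed f u w)) => // /boxed_ball->.
  by rewrite leq_mul2l emax ?orbT.
have := leq_trans (box_count k f) (leq_mul box_le (leqnn _)).
rewrite cnt kq; set M := #|E| in E0 *; set G := #|_|.
have -> : #|T| ^ (2 * k) = (#|T| ^ k) ^ 2 by rewrite -expnM mulnC.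
rewrite expnM; set N := #|T| ^ k in N0 *; set c := k`! in F0 *.
(* Split off the factor common to both sides. Cancelling it leaves a surplus factor [c ^ q] on the
   left, which is at least 1. *)
have -> : (c * M) ^ q.+2 * N ^ 2 = (c * M * c * N ^ 2) * (M * (c * M) ^ q).
  by rewrite !expnS; ring.
have -> : c * M * (c * G) * N ^ q.+2 = (c * M * c * N ^ 2) * (G * N ^ q).
  by rewrite !expnS; ring.
rewrite leq_pmul2l => [H|]; last by rewrite -mulnn !muln_gt0 F0 E0 N0.
apply: leq_trans _ H.
by rewrite expnS expnMn leq_mul2l leq_pmull ?expn_gt0 ?F0 // orbT.
Qed.

End Balls.

(** * Tight paths of length at most 3 inside a ball *)

Section Diameter.
Variables (T : finType) (k : nat) (F : {set {set T}}).
Hypothesis unifF : uniform k F.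

(** Each edge of the explicit paths below is checked by splitting the vertex sequence around its
    window [s2]. *)
Lemma take_drop_set (s1 s2 s3 s : seq T) (A : {set T}) :
  s = s1 ++ s2 ++ s3 -> size s2 = k -> [set x in s2]%SET = A -> A \in F ->
  [set x in take k (drop (size s1) s)]%SET \in F.
Proof. by move=> -> sz2 <- ?; rewrite drop_size_cat // -sz2 take_size_cat. Qed.

Definition linked (u v : T) : Prop :=
  exists l p, [/\ l <= 3, tight_path k F l (u :: p) & last u p = v].

Lemma linked1 A u v : A \in F -> u \in A -> v \in A -> u != v -> linked u v.
Proof.
move=> AF uA vA uv; pose s := enum (A :\ u :\ v).
have szk : size (u :: rcons s v) = k.
  rewrite /= size_rcons -cardE -(unifF AF) (cardsD1 u A) uA.
  by rewrite (cardsD1 v (A :\ u)) !inE vA eq_sym uv.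
exists 1, (rcons s v); split=> //; last by rewrite last_rcons.
apply/and4P; split=> //; first by rewrite szk add1n subn1.
  rewrite /= mem_rcons inE negb_or uv rcons_uniq enum_uniq !mem_enum !inE !eqxx.
  by rewrite andbF.
apply/allP=> -[|//] _.
apply: (@take_drop_set [::] (u :: rcons s v) [::] _ A) => //.
  by rewrite cats0.
apply/setP=> z; rewrite !inE mem_rcons inE mem_enum !inE.
have [->|_] := eqVneq z u; first by rewrite uA.
by have [->|_] := eqVneq z v; first by rewrite vA.
Qed.

Lemma linked2 (S : {set T}) u v : u |: S \in F -> v |: S \in F ->
  u \notin S -> v \notin S -> u != v -> linked u v.
Proof.
move=> uF vF uS vS uv; pose s := enum S.
have szs : (size s).+1 = k by rewrite -cardE -(unifF uF) cardsU1 uS.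
exists 2, (rcons s v); split=> //; last by rewrite last_rcons.
have sS : [set x in s]%SET = S by apply/setP=> z; rewrite inE mem_enum.
apply/and4P; split=> //; first by rewrite /= size_rcons szs add2n subn1.
  by rewrite /= mem_rcons inE negb_or uv rcons_uniq !mem_enum uS vS enum_uniq.
apply/allP=> -[|[|//]] _.
  apply: (@take_drop_set [::] (u :: s) [:: v] _ (u |: S)) => //.
    by rewrite /= cats1.
  by rewrite set_cons sS.
apply: (@take_drop_set [:: u] (rcons s v) [::] _ (v |: S)) => //.
- by rewrite cats0.
- by rewrite size_rcons.
- by apply/setP=> z; rewrite !inE mem_rcons inE mem_enum.
Qed.

(** The three windows of the sequence [u], [y], [S], [x], [v] are the three given edges. *)
Lemma linked3 (S : {set T}) u y x v :
    [set u; y] :|: S \in F -> [set y; x] :|: S \in F ->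
    [set x; v] :|: S \in F ->
    u \notin S -> y \notin S -> x \notin S -> v \notin S ->
    uniq [:: u; y; x; v] -> linked u v.
Proof.
move=> F1 F2 F3 uS yS xS vS; rewrite /= !inE !negb_or.
case/and4P=> /and3P[uy ux uv] /andP[yx yv] xv _; pose s := enum S.
have szs : (size s).+2 = k.
  by rewrite -cardE -(unifF F1) -finset.setUA !cardsU1 !inE negb_or uy uS yS.
exists 3, (y :: s ++ [:: x; v]); split=> //; last by rewrite /= last_cat.
have sS : [set x in s]%SET = S by apply/setP=> z; rewrite inE mem_enum.
apply/and4P; split=> //.
- by rewrite /= size_cat /= addn2 szs addSn subn1 add2n.
- rewrite /= !inE !mem_cat !inE !negb_or cat_uniq enum_uniq /= !mem_enum !inE.
  by rewrite uS yS (negPf xS) (negPf vS) uy ux uv yx yv xv.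
apply/allP=> -[|[|[|//]]] _.
- apply: (@take_drop_set [::] [:: u, y & s] [:: x; v] _ ([set u; y] :|: S)) => //.
  by apply/setP=> z; rewrite !inE mem_enum orbA.
- apply: (@take_drop_set [:: u] (y :: rcons s x) [:: v] _ ([set y; x] :|: S)) => //.
  + by rewrite /= cat_rcons.
  + by rewrite /= size_rcons.
  + by apply/setP=> z; rewrite !inE mem_rcons inE mem_enum orbA.
- apply: (@take_drop_set [:: u; y] (s ++ [:: x; v]) [::] _ ([set x; v] :|: S)) => //.
  + by rewrite cats0.
  + by rewrite size_cat addn2.
  + by apply/setP=> z; rewrite !inE mem_cat mem_enum !inE orbC.
Qed.

Definition near (e : {set T}) (v : T) : Prop :=
  v \in e \/ exists2 x, x \in e & v |: e :\ x \in F.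

(** If both vertices lie in one edge, length 1 suffices. If both complete the same set [e :\ x] to
    an edge, length 2 does. Otherwise [u] replaces [x] and [v] replaces some [y] other than [x], and
    the path of length 3 has [e] as its middle edge. *)
Lemma linked_near (e : {set T}) u v :
  e \in F -> near e u -> near e v -> u != v -> linked u v.
Proof.
move=> eF nu nv uv.
have [ue|ue] := boolP (u \in e); have [ve|ve] := boolP (v \in e).
- exact: linked1 eF ue ve uv.
- case: nv => [/(negP ve)//|[x xe xF]].
  have [ux|ux] := eqVneq u x; last first.
    by apply: linked1 xF _ _ uv; rewrite !inE ?eqxx ?ux ?ue ?orbT.
  rewrite -ux in xF.
  by apply: (@linked2 (e :\ u));
    rewrite ?finset.setD1K // !inE ?eqxx // (negPf ve) andbF.
- case: nu => [/(negP ue)//|[x xe xF]].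
  have [vx|vx] := eqVneq v x; last first.
    by apply: linked1 xF _ _ uv; rewrite !inE ?eqxx ?vx ?ve ?orbT.
  rewrite -vx in xF.
  by apply: (@linked2 (e :\ v));
    rewrite ?finset.setD1K // !inE ?eqxx // (negPf ue) andbF.
case: nu => [/(negP ue)//|[x xe xF]]; case: nv => [/(negP ve)//|[y ye yF]].
have [xy|xy] := eqVneq x y.
  rewrite -xy in yF.
  by apply: (@linked2 (e :\ x)) => //;
    rewrite !inE ?(negPf ve) ?(negPf ue) andbF.
have D a b : a \in e -> a != b -> a |: e :\ b :\ a = e :\ b.
  by move=> ae ab; rewrite finset.setD1K // !inE ab.
have yx : y != x by rewrite eq_sym.
have S_xy : e :\ x :\ y = e :\ y :\ x.
  by rewrite finset.setDDl finset.setUC -finset.setDDl.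
apply: (@linked3 (e :\ x :\ y) u y x v).
- by rewrite -finset.setUA D.
- by rewrite (finset.setUC [set y]) -finset.setUA D // finset.setD1K.
- by rewrite (finset.setUC [set x]) -finset.setUA S_xy D.
- by rewrite !inE (negPf ue) !andbF.
- by rewrite !inE eqxx.
- by rewrite !inE eqxx andbF.
- by rewrite !inE (negPf ve) !andbF.
rewrite /= !inE !negb_or uv yx.
by rewrite (memPnC ue _ ye) (memPnC ue _ xe) (memPn ve _ ye) (memPn ve _ xe).
Qed.

Lemma diam_near (R : realType) (e : {set T}) : e \in F ->
  (forall v, v \in finset.cover F -> near e v) -> (diam R k F <= (3%:R)%:E)%E.
Proof.
move=> eF nearF; apply: bigmax_le => [|[u v] /= /and3P[uF vF uv]].
  by rewrite lee_fin ler0n.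
have [l [p [l3 lp pv]]] := linked_near eF (nearF u uF) (nearF v vF) uv.
apply: (@le_trans _ _ (l%:R%:E)%E); last by rewrite lee_fin ler_nat.
by apply: ereal_inf_lbound; exists l => //; exists p.
Qed.

End Diameter.

Lemma diam_set0 (R : realType) (T : finType) k :
  (diam R k (finset.set0 : {set {set T}}) <= (3%:R)%:E)%E.
Proof.
apply: bigmax_le => [|p]; first by rewrite lee_fin ler0n.
by rewrite /finset.cover big_set0 inE.
Qed.

(** The connecting paths stay in the class: an edge [v |: e :\ x] has all its vertices in the ball,
    so it is itself in [ball_edges E e]. *)
Lemma diam_ball_edges (R : realType) (T : finType) k (E : {set {set T}}) e :
  uniform k E -> e \in E -> (diam R k (ball_edges E e) <= (3%:R)%:E)%E.
Proof.
move=> unifE eE.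
have eF : e \in ball_edges E e by rewrite inE eE finset.subsetUl.
apply: (diam_near _ _ eF) => [A|v]; first by rewrite inE => /andP[/unifE].
case/bigcupP=> A; rewrite inE => /andP[_ /fintype.subsetP Ae] /Ae vB.
move: (vB); rewrite !inE => /orP[|/existsP[x /andP[xe xE]]]; [by left|right].
exists x => //; rewrite inE xE finset.subUset finset.sub1set vB.
apply/fintype.subsetP=> z; rewrite !inE => /andP[_ ->] //.
Qed.

Lemma card_uniform (T : finType) k (E : {set {set T}}) :
  uniform k E -> #|E| <= #|T| ^ k.
Proof.
move=> unifE; apply: (@leq_trans (k`! * #|E|)).
  by rewrite leq_pmull ?fact_gt0.
rewrite -(card_tuples_set unifE) -card_tuple -sum1_card.
by apply: leq_sum => t _; exact: leq_b1.
Qed.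

(** * Greedy removal of balls and the decay of the density *)

Local Open Scope ring_scope.

(* With [x = m ^+ q]: [(t + 1) x (1 - x) <= (1 - x) + x (1 - x) = 1 - x ^ 2]. *)
Lemma density_step (R : realFieldType) (t q : nat) (m m' : R) : (0 < q)%N ->
  0 <= m <= 1 -> 0 <= m' <= m - m ^+ q.+1 -> t%:R * m ^+ q <= 1 ->
  t.+1%:R * m' ^+ q <= 1.
Proof.
move=> q0 /andP[m0 m1] /andP[m'0 m'm]; set x := m ^+ q => tx.
have x0 : 0 <= x by exact: exprn_ge0.
have x1 : x <= 1 by exact: exprn_ile1.
have {}m'm : m' <= m * (1 - x) by rewrite mulrBr mulr1 -exprS.
have m'x : m' ^+ q <= x * (1 - x).
  apply: (@le_trans _ _ ((m * (1 - x)) ^+ q)).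
    by rewrite lerXn2r // nnegrE // (le_trans m'0).
  (* Since [q] is positive, (1 - x)^q <= 1 - x. *)
  rewrite exprMn ler_wpM2l // -[leRHS]expr1.
  by apply: ler_wiXn2l; rewrite ?subr_ge0 // gerBl.
apply: le_trans (ler_wpM2l (ler0n _ _) m'x) _.
rewrite -natr1; nra.
Qed.

(** The partition is encoded by labels: [c A] is the number of the round that removes [A], or 0 if
    [A] remains. The last clause is the invariant of [density_step] for the density of the remaining
    edges. *)
Lemma greedy (R : realType) (T : finType) k q (E : {set {set T}}) t :
  (2 ^ k = q.+2)%N -> (0 < q)%N -> (0 < #|T|)%N -> uniform k E ->
  exists c : {set T} -> nat,
  [/\ forall A, (c A <= t)%N,
      forall i, (0 < i)%N -> (diam R k [set A in E | c A == i]%SET <= 3%:R%:E)%E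
    & t%:R * (#|[set A in E | c A == 0%N]%SET|%:R / #|T|%:R ^+ k) ^+ q
        <= 1 :> R].
Proof.
move=> kq q0 T0 unifE; elim: t => [|t [c [ct cdiam cE]]].
  exists (fun=> 0%N); split=> //.
  case=> // i _; rewrite (_ : [set A in E | _]%SET = finset.set0) ?diam_set0 //.
  by apply/setP=> A; rewrite !inE andbF.
set E0 := [set A in E | c A == 0%N]%SET in cE.
have unif0 : uniform k E0 by move=> A; rewrite inE => /andP[/unifE].
have N0 : 0 < #|T|%:R ^+ k :> R by rewrite exprn_gt0 ?ltr0n.
have [G [GE Gdiam Gcard]] : exists G : {set {set T}}, [/\ G \subset E0,
    (diam R k G <= 3%:R%:E)%E & (#|E0| ^ q.+1 <= #|G| * (#|T| ^ k) ^ q)%N].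
  (* Once no edge remains, the round removes an empty class. *)
  have [->|E0n] := eqVneq E0 finset.set0.
    by exists finset.set0; rewrite finset.sub0set diam_set0 cards0 exp0n.
  have [e eE0 eG] := dense_ball unif0 kq E0n.
  exists (ball_edges E0 e); split=> //; last exact: diam_ball_edges.
  by apply/fintype.subsetP=> A; rewrite inE => /andP[].
have GP A : A \in G -> A \in E /\ c A = 0%N.
  by move/(fintype.subsetP GE); rewrite inE => /andP[? /eqP].
exists (fun A => if A \in G then t.+1 else c A); split.
- by move=> A; case: ifP => // _; exact: leqW.
- move=> i i0; have [->|it] := eqVneq i t.+1.
    rewrite (_ : [set A in E | _]%SET = G) //; apply/setP=> A; rewrite !inE.
    case: ifPn => [/GP[-> _]|AG]; first by rewrite eqxx.
    by rewrite ltn_eqF ?andbF // ltnS.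
  rewrite (_ : [set A in E | _]%SET = [set A in E | c A == i]%SET) ?cdiam //.
  apply/setP=> A; rewrite !inE; case: ifPn => // /GP[_ ->].
  by rewrite eq_sym (negPf it) eq_sym (gtn_eqF i0).
rewrite (_ : [set A in E | _]%SET = E0 :\: G); last first.
  by apply/setP=> A; rewrite !inE; case: ifPn => //=; rewrite andbF.
apply: density_step cE => //.
  rewrite divr_ge0 ?ler0n ?(ltW N0) // ler_pdivrMr // mul1r -natrX ler_nat.
  exact: card_uniform.
rewrite divr_ge0 ?ler0n ?(ltW N0) //=.
rewrite cardsD (finset.setIidPr GE) natrB ?subset_leq_card //.
rewrite mulrBl lerD2l lerN2.
(* What is left is [Gcard] divided by the power [q.+1] of |T|^k. *)
rewrite exprMn exprVn ler_pdivlMr // -mulrA.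
move: Gcard; rewrite -(ler_nat R) natrM !natrX => Gcard.
rewrite [(_ ^+ k) ^+ q.+1]exprSr invfM -mulrA mulVf ?mulr1 ?gt_eqF //.
rewrite ler_pdivrMr; last exact: exprn_gt0.
exact: Gcard.
Qed.

(** * The number of rounds and the final bound *)

Theorem theorem1p6 (R : realType) (k : nat) (hk : (2 <= k)%N) :
  exists C K : R, [/\ 0 < C, 0 < K
    & forall (n : nat) (eps : R), (0 < n)%N -> eps <= 1 ->
      K * n%:R `^ (- 2 ^ (1 - k%:Z)) <= eps ->
      (Pdiam k n eps 3 <= (C * eps ^ (2 - 2 ^+ k))%:E)%E].
Proof.
(* The constant 2 absorbs rounding: the number of rounds is at most [y] + 1 <= 2 [y], where [y], the
   power -[q] of [eps], is at least 1. *)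
exists 2, 1; split=> // n eps n0 eps1; rewrite mul1r => eps_ge.
have eps0 : 0 < eps by apply: lt_le_trans eps_ge; rewrite powR_gt0 ?ltr0n.
have [q q0 kq] : exists2 q, (0 < q)%N & (2 ^ k = q.+2)%N.
  exists (2 ^ k - 2)%N; last first.
    by rewrite -[in RHS]addn2 subnK // (leq_pexp2l _ (ltnW hk)).
  by rewrite subn_gt0 (@leq_trans (2 ^ 2)) // leq_pexp2l.
have -> : eps ^ (2 - 2 ^+ k) = eps ^- q.
  have -> : 2 - 2 ^+ k = - q%:Z :> int.
    by rewrite -natrX kq -(addn2 q) natrD opprD addrCA subrr addr0 natz.
  by rewrite exprnN.
set y := eps ^- q.
have y1 : 1 <= y by rewrite invf_ge1 ?exprn_gt0 // exprn_ile1 // ltW.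
have /andP[ty yt] := truncn_itv (le_trans ler01 y1).
(* The successor makes [t] strictly larger than [y], as the contradiction below requires. *)
pose t := (Num.truncn y).+1.
apply: (@le_trans _ _ t%:R%:E); last first.
  by rewrite lee_fin -[t%:R]natr1; lra.
apply: ereal_inf_lbound; exists t => // E unifE.
have T0 : (0 < #|'I_n|)%N by rewrite card_ord.
have [c [ct cdiam cE]] := greedy R t kq q0 T0 unifE.
exists (fun i : 'I_t.+1 => [set A in E | c A == i :> nat]%SET); split.
- apply/setP=> A; apply/bigcupP/idP => [[i _]|AE].
    by rewrite inE => /andP[].
  have cA : (c A < t.+1)%N by rewrite ltnS.
  by exists (Ordinal cA) => //; rewrite inE AE /=.
- move=> i j ij; rewrite -setI_eq0; apply/eqP/setP=> A; rewrite !inE.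
  have [->|//] := eqVneq (c A) i; rewrite ?andbF //.
  by rewrite (inj_eq val_inj) (negPf ij) !andbF.
- rewrite card_ord in cE; rewrite -ler_pdivrMr ?exprn_gt0 ?ltr0n // leNgt.
  apply/negP=> lt_eps; move: cE; apply/negP; rewrite -ltNge.
  (* If the remaining density m exceeded [eps], then 1 = y eps^q < t m^q, against the invariant. *)
  rewrite -[ltLHS](@mulVf _ (eps ^+ q)) ?gt_eqF ?exprn_gt0 // -/y.
  apply: ltr_pM; rewrite ?(ltW (lt_le_trans ltr01 y1)) ?exprn_ge0 ?(ltW eps0) //.
  by rewrite ltrXn2r ?(ltW eps0) // -lt0n.
- move=> i i0; apply: cdiam; rewrite lt0n; apply: contra i0 => /eqP i0.
  by apply/eqP/val_inj.
Qed.
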